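(* For locally quasi-convex abelian groups $G$ and $H$ the following assertions are equivalent: (i) the product $G\times H$ is a Mackey group; (ii) for every $S\in\mathrm{Mac}(G\times H)$, the projections $K:=\pi_{\widehat{G}}(S)$ and $C:=\pi_{\widehat{H}}(S)$ of $S$ onto $\widehat{G}$ and $\widehat{H}$ are equicontinuous; (iii) $G$ and $H$ are Mackey groups and $\mathrm{Mac}(G)\times\mathrm{Mac}(H)$ swallows $\mathrm{Mac}(G\times H)$.
   Context: Abelian groups are written additively. $\mathbb{S}$ is the unit circle group and $\mathbb{S}_+=\{z\in\mathbb{S}:\mathrm{Re}(z)\ge 0\}$. For an abelian topological group $G=(G,\tau)$, $\widehat{G}$ is the group of continuous characters (continuous homomorphisms $G\to\mathbb{S}$), $G^\ast$ is the group of all homomorphisms $G\to\mathbb{S}$, and $(\chi,g):=\chi(g)$. For $A\subseteq G$: $A^{\triangleright}=\{\chi\in\widehat{G}:\chi(A)\subseteq\mathbb{S}_+\}$ and $A^{\blacktriangleright}=\{\chi\in G^\ast:\chi(A)\subseteq\mathbb{S}_+\}$. For $B\subseteq\widehat{G}$: $B^{\triangleleft}=\{g\in G:(\chi,g)\in\mathbb{S}_+ \text{ for all }\chi\in B\}$. For a subset $A$ of an abelian group, $(1)A:=A$ and $(n+1)A:=(n)A+A$. A subset $A$ of an abelian topological group $G$ is quasi-convex if for every $g\in G\setminus A$ there is $\chi\in\widehat{G}$ with $\chi(A)\subseteq\mathbb{S}_+$ and $\chi(g)\notin\mathbb{S}_+$. $G$ (or its topology) is locally quasi-convex if it is Hausdorff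 and has a neighborhood base at $0$ of quasi-convex sets. $\sigma(\widehat{G},G)$ is the topology of pointwise convergence on $G$; $\widehat{G}_{\sigma^\ast}:=(\widehat{G},\sigma(\widehat{G},G))$, whose continuous characters are exactly the evaluations at elements of $G$ (so $K\subseteq\widehat{G}_{\sigma^\ast}$ is quasi-convex iff $K=K^{\triangleleft\triangleright}$). $\mathrm{Mac}(G)$ is the family of all quasi-convex compact subsets $K$ of $\widehat{G}_{\sigma^\ast}$ such that for every finite $F\subseteq\widehat{G}$ with $0\in F$ and every integer $n\ge1$, the subset $((n)K+F)^{\triangleleft\blacktriangleright}$ of $G^\ast$ is contained in $\widehat{G}$. The dual group $\widehat{G\times H}$ is identified with $\widehat{G}\times\widehat{H}$, with projections $\pi_{\widehat{G}},\pi_{\widehat{H}}$, and $\mathrm{Mac}(G)\times\mathrm{Mac}(H)$ denotes the family $\{K\times C: K\in\mathrm{Mac}(G),\,C\in\mathrm{Mac}(H)\}$ of subsets of $\widehat{G}\times\widehat{H}$. A family $\mathcal{B}$ of sets swallows a family $\mathcal{A}$ if every $A\in\mathcal{A}$ is contained in some $B\in\mathcal{B}$. Two group topologies $\mu,\nu$ on $G$ are compatible if $\widehat{(G,\mu)}=\widehat{(G,\nu)}$. A locally quasi-convex abelian group $(G,\tau)$ is a Mackey group if $\nu\le\tau$ for every locally quasi-convex group topology $\nu$ on $G$ compatible with $\tau$. A set $K\subseteq\widehat{G}$ is equicontinuous if for every neighborhood $V$ of the identity in $\mathbb{S}$ there is a neighborhood $U$ of $0$ in $G$ with $\chi(U)\subseteq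 V$ for all $\chi\in K$. *)

(* Defs.v *)
From HB Require Import structures.
From mathcomp Require Import all_boot all_order all_algebra.
From mathcomp Require Import all_classical all_reals topology normedtype.
From mathcomp Require Import complex.

Set Implicit Arguments.
Unset Strict Implicit.
Unset Printing Implicit Defensive.

Import Order.TTheory GRing.Theory Num.Theory.
Import numFieldNormedType.Exports.

Local Open Scope classical_set_scope.
Local Open Scope ring_scope.
Local Open Scope complex_scope.

(** The circle group, written additively: [+] on [circle R] is multiplication
    of complex numbers and [0 : circle R] is the complex number 1. *)

Record circle (R : realType) := Circle {
  circle_val : R[i] ;
  circle_valP : `|circle_val| == 1 }.

HB.instance Definition _ (R : realType) := [isSub for @circle_val R].
HB.instance Definition _ (R : realType) := [Choice of circle R by <:].

Section Circle.
Variable R : realType.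
Implicit Types z w : circle R.

Lemma circle_add_subproof z w : `|circle_val z * circle_val w| == 1.
Proof. by rewrite normrM (eqP (circle_valP z)) (eqP (circle_valP w)) mulr1. Qed.

Lemma circle_opp_subproof z : `|(circle_val z)^-1| == 1.
Proof. by rewrite normfV (eqP (circle_valP z)) invr1. Qed.

Lemma circle_zero_subproof : `|1 : R[i]| == 1.
Proof. by rewrite normr1. Qed.

Definition circle_add z w := Circle (circle_add_subproof z w).
Definition circle_opp z := Circle (circle_opp_subproof z).
Definition circle_zero : circle R := Circle circle_zero_subproof.

Lemma circle_addA : associative circle_add.
Proof. by move=> x y z; apply: val_inj; rewrite /= mulrA. Qed.

Lemma circle_addC : commutative circle_add.
Proof. by move=> x y; apply: val_inj; rewrite /= mulrC. Qed.

Lemma circle_add0 : left_id circle_zero circle_add.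
Proof. by move=> x; apply: val_inj; rewrite /= mul1r. Qed.

Lemma circle_val_neq0 z : circle_val z != 0.
Proof. by rewrite -normr_gt0 (eqP (circle_valP z)) ltr01. Qed.

Lemma circle_addN : left_inverse circle_zero circle_opp circle_add.
Proof. by move=> x; apply: val_inj; rewrite /= mulVf// circle_val_neq0. Qed.

HB.instance Definition _ := GRing.isZmodule.Build (circle R)
  circle_addA circle_addC circle_add0 circle_addN.

HB.instance Definition _ := Topological.copy (circle R)
  (initial_topology (@circle_val R : circle R -> R[i]^o)).

Lemma circle_val_continuous : continuous (@circle_val R : circle R -> R[i]^o).
Proof. exact: initial_continuous. Qed.

Lemma circle_sub_continuous :
  continuous (fun x : circle R * circle R => x.1 - x.2).
Proof.
apply: (@continuous_comp_initial _ _ _ (@circle_val R : circle R -> R[i]^o)).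
move=> [z w].
apply: (@cvgM R[i] _ _ _ (fun x : circle R * circle R => circle_val x.1)
   (fun x : circle R * circle R => (circle_val x.2)^-1)
   (circle_val z) (circle_val w)^-1).
  apply: (@cvg_comp _ _ _ fst (@circle_val R) _ (nbhs z)); first exact: cvg_fst.
  exact: circle_val_continuous.
apply: (@cvgV R[i] _ _ _ (fun x : circle R * circle R => circle_val x.2)).
  exact: circle_val_neq0.
apply: (@cvg_comp _ _ _ snd (@circle_val R) _ (nbhs w)); first exact: cvg_snd.
exact: circle_val_continuous.
Qed.

HB.instance Definition _ :=
  PreTopologicalNmodule_isTopologicalZmodule.Build (circle R)
    circle_sub_continuous.

Definition circle_plus : set (circle R) :=
  [set z | 0 <= complex.Re (circle_val z)].

End Circle.

(** Group topologies on a fixed abelian group, so that several of them can be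
    compared; [retop nu] is [G] carrying the topology [nu]. *)

Record group_topology (G : zmodType) := GroupTopology {
  gt_open : set_system G ;
  gt_openT : gt_open setT ;
  gt_openI : setI_closed gt_open ;
  gt_open_bigcup : forall (I : Type) (f : I -> set G),
    (forall i, gt_open (f i)) -> gt_open (\bigcup_i f i) ;
  gt_sub_continuous : forall (x y : G) (U : set G), gt_open U -> U (x - y) ->
    exists V W : set G, [/\ gt_open V, gt_open W, V x, W y &
      forall v w, V v -> W w -> U (v - w)] }.

Definition retop (G : zmodType) (nu : group_topology G) : Type := G.

Section Retop.
Variables (G : zmodType) (nu : group_topology G).

HB.instance Definition _ := GRing.Zmodule.copy (retop nu) G.

HB.instance Definition _ := isOpenTopological.Build (retop nu)
  (gt_openT nu) (@gt_openI _ nu) (@gt_open_bigcup _ nu).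

Lemma retop_sub_continuous :
  continuous (fun x : retop nu * retop nu => x.1 - x.2).
Proof.
move=> [x y] A /=; rewrite nbhsE => -[U [oU Uxy] UA].
have [V [W [oV oW Vx Wy VWU]]] := gt_sub_continuous oU Uxy.
exists (V, W); first by split; apply: open_nbhs_nbhs.
by move=> [v w] /= [Vv Ww]; apply: UA; exact: VWU.
Qed.

HB.instance Definition _ :=
  PreTopologicalNmodule_isTopologicalZmodule.Build (retop nu)
    retop_sub_continuous.

End Retop.

(** The library equips [(G * H)%type] with a [topologicalZmodType] structure
    only when [G] and [H] are topological vector spaces; [gprod] is an alias
    carrying the componentwise addition and the product topology. *)

Definition gprod (G H : topologicalZmodType) : Type := (G * H)%type.

Section Product.
Variables G H : topologicalZmodType.

HB.instance Definition _ := GRing.Zmodule.copy (gprod G H) (G * H)%type.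
HB.instance Definition _ := Topological.copy (gprod G H) (G * H)%type.

Lemma gprod_sub_continuous :
  continuous (fun x : gprod G H * gprod G H => x.1 - x.2).
Proof.
move=> [[/= g h] [/= g' h']] U [[A B] /= [nA nB] ABU].
have [[/= A1 A2] [nA1 nA2] A12] := @sub_continuous G (g, g') _ nA.
have [[/= B1 B2] [nB1 nB2] B12] := @sub_continuous H (h, h') _ nB.
exists (A1 `*` B1, A2 `*` B2); first by split; [exists (A1, B1)|exists (A2, B2)].
move=> [[a b] [a' b']] /= [[Aa Bb] [Aa' Bb']]; apply: ABU; split.
  exact: (A12 (a, a')).
exact: (B12 (b, b')).
Qed.

HB.instance Definition _ :=
  PreTopologicalNmodule_isTopologicalZmodule.Build (gprod G H)
    gprod_sub_continuous.

End Product.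

Lemma additive_ext (U V : zmodType) (f h : {additive U -> V}) :
  f =1 h -> f = h.
Proof.
case: f h => [f cf] [h ch] /= /funext fh; subst h; congr Algebra.Additive.Pack.
by case: cf ch => [[a]] [[b]]; rewrite (Prop_irrelevance a b).
Qed.

(** [G^*] is the library type [{additive G -> circle R}]; [dual R G] is the
    group of continuous characters, always equipped with the topology of
    pointwise convergence [sigma(dual R G, G)]. *)

Record dual (R : realType) (G : topologicalZmodType) := Dual {
  dual_hom :> {additive G -> circle R} ;
  dual_continuous : continuous (dual_hom : G -> circle R) }.

Section Dual.
Variables (R : realType) (G : topologicalZmodType).
Implicit Types chi psi : dual R G.

Lemma dual_ext chi psi : (forall g, chi g = psi g) -> chi = psi.
Proof.
case: chi psi => [f cf] [h ch] /= /additive_ext fh; subst h.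
by rewrite (Prop_irrelevance cf ch).
Qed.

Lemma dual_add_subproof chi psi :
  continuous ((dual_hom chi \+ dual_hom psi)%R : G -> circle R).
Proof.
move=> g; apply: (@continuous_comp _ _ _ (fun g => (chi g, psi g))
  (fun z : circle R * circle R => z.1 + z.2)); last exact: add_continuous.
by exact: (cvg_pair (@dual_continuous _ _ chi g) (@dual_continuous _ _ psi g)).
Qed.

Lemma dual_opp_subproof chi :
  continuous ((\- dual_hom chi)%R : G -> circle R).
Proof.
move=> g; apply: (@continuous_comp _ _ _ (chi : G -> circle R)
  (-%R : circle R -> circle R)); first exact: dual_continuous.
exact: opp_continuous.
Qed.

Lemma dual_zero_subproof : continuous (\0%R : G -> circle R).
Proof. by move=> g; exact: cvg_cst. Qed.

Definition dual_add chi psi : dual R G := Dual (@dual_add_subproof chi psi).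
Definition dual_opp chi : dual R G := Dual (@dual_opp_subproof chi).
Definition dual_zero : dual R G := Dual dual_zero_subproof.

Lemma dual_addA : associative dual_add.
Proof. by move=> x y z; apply: dual_ext => g /=; rewrite addrA. Qed.

Lemma dual_addC : commutative dual_add.
Proof. by move=> x y; apply: dual_ext => g /=; rewrite addrC. Qed.

Lemma dual_add0 : left_id dual_zero dual_add.
Proof. by move=> x; apply: dual_ext => g /=; rewrite add0r. Qed.

Lemma dual_addN : left_inverse dual_zero dual_opp dual_add.
Proof. by move=> x; apply: dual_ext => g /=; rewrite addNr. Qed.

HB.instance Definition _ := gen_eqMixin (dual R G).
HB.instance Definition _ := gen_choiceMixin (dual R G).
HB.instance Definition _ := GRing.isZmodule.Build (dual R G)
  dual_addA dual_addC dual_add0 dual_addN.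

Definition dual_fun chi : {ptws G -> circle R} := fun g => chi g.

HB.instance Definition _ :=
  Topological.copy (dual R G) (initial_topology dual_fun).

Lemma dual_eval_continuous (g : G) : continuous (fun chi => chi g).
Proof.
move=> chi; apply: (@continuous_comp _ _ _ dual_fun (fun f => f g)).
  exact: initial_continuous.
exact: (@proj_continuous _ (fun=> circle R) g).
Qed.

Lemma dual_sub_continuous :
  continuous (fun x : dual R G * dual R G => x.1 - x.2).
Proof.
apply: (@continuous_comp_initial _ _ _ dual_fun) => -[chi psi].
apply/cvg_sup => g.
apply: (@continuous_comp_initial _ _ _ (fun f : G -> circle R => f g)) => {chi psi} -[chi psi].
apply: (@continuous_comp _ _ _ (fun x : dual R G * dual R G => (x.1 g, x.2 g))
  (fun z : circle R * circle R => z.1 - z.2)); last exact: sub_continuous.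
apply: (cvg_pair (G := nbhs (chi g)) (H := nbhs (psi g))).
  by apply: (@cvg_comp _ _ _ fst (fun chi : dual R G => chi g) _ (nbhs chi));
    [exact: cvg_fst|exact: dual_eval_continuous].
by apply: (@cvg_comp _ _ _ snd (fun chi : dual R G => chi g) _ (nbhs psi));
  [exact: cvg_snd|exact: dual_eval_continuous].
Qed.

HB.instance Definition _ :=
  PreTopologicalNmodule_isTopologicalZmodule.Build (dual R G)
    dual_sub_continuous.

End Dual.

Section Polars.
Variables (R : realType) (G : topologicalZmodType).

Definition polar (A : set G) : set (dual R G) :=
  [set chi | chi @` A `<=` @circle_plus R].

Definition algebraic_polar (A : set G) : set {additive G -> circle R} :=
  [set chi | chi @` A `<=` @circle_plus R].

Definition prepolar (B : set (dual R G)) : set G :=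
  [set g | forall chi, B chi -> circle_plus (chi g)].

Definition quasi_convex (A : set G) :=
  forall g, ~ A g -> exists2 chi, polar A chi & ~ circle_plus (chi g).

Definition locally_quasi_convex :=
  hausdorff_space G /\
  forall U : set G, nbhs 0 U ->
    exists V : set G, [/\ nbhs 0 V, quasi_convex V & V `<=` U].

Definition equicontinuous_dual (K : set (dual R G)) :=
  forall V : set (circle R), nbhs 0 V ->
    exists2 U : set G, nbhs 0 U & forall chi, K chi -> chi @` U `<=` V.

End Polars.

Definition sumset (V : zmodType) (A B : set V) : set V :=
  [set a + b | a in A & b in B].

(** [nfold n A] is [(n)A] for [n >= 1]; [nfold 0 A] is a junk value. *)
Definition nfold (V : zmodType) (n : nat) (A : set V) : set V :=
  iter n.-1 (fun B => sumset B A) A.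

Definition Mac (R : realType) (G : topologicalZmodType) :
    set (set (dual R G)) :=
  [set K | [/\ quasi_convex R K, compact K &
    forall (F : set (dual R G)) (n : nat), finite_set F -> F 0 -> (0 < n)%N ->
      algebraic_polar (prepolar (sumset (nfold n K) F)) `<=`
      [set chi : {additive G -> circle R} |
        continuous (chi : G -> circle R)]]].

Definition compatible (R : realType) (G : topologicalZmodType)
    (nu : group_topology G) :=
  [set chi : {additive G -> circle R} | continuous (chi : G -> circle R)] =
  [set chi : {additive G -> circle R} |
    continuous (chi : retop nu -> circle R)].

Definition mackey (R : realType) (G : topologicalZmodType) :=
  locally_quasi_convex R G /\
  forall nu : group_topology G,
    locally_quasi_convex R (retop nu) -> compatible R nu ->
    gt_open nu `<=` (open : set_system G).

Section DualProduct.
Variables (R : realType) (G H : topologicalZmodType).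

Definition gprod_inl (g : G) : gprod G H := (g, 0).
Definition gprod_inr (h : H) : gprod G H := (0, h).
Definition gprod_fst (x : gprod G H) : G := x.1.
Definition gprod_snd (x : gprod G H) : H := x.2.

Lemma gprod_inl_is_additive : zmod_morphism gprod_inl.
Proof. by move=> x y; rewrite /gprod_inl -[in LHS](subr0 0). Qed.

Lemma gprod_inr_is_additive : zmod_morphism gprod_inr.
Proof. by move=> x y; rewrite /gprod_inr -[in LHS](subr0 0). Qed.

Lemma gprod_fst_is_additive : zmod_morphism gprod_fst. Proof. by []. Qed.
Lemma gprod_snd_is_additive : zmod_morphism gprod_snd. Proof. by []. Qed.

HB.instance Definition _ :=
  GRing.isZmodMorphism.Build G (gprod G H) gprod_inl gprod_inl_is_additive.
HB.instance Definition _ :=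
  GRing.isZmodMorphism.Build H (gprod G H) gprod_inr gprod_inr_is_additive.
HB.instance Definition _ :=
  GRing.isZmodMorphism.Build (gprod G H) G gprod_fst gprod_fst_is_additive.
HB.instance Definition _ :=
  GRing.isZmodMorphism.Build (gprod G H) H gprod_snd gprod_snd_is_additive.

Lemma gprod_inl_continuous : continuous gprod_inl.
Proof. by move=> g; exact: (cvg_pair cvg_id (cvg_cst _)). Qed.

Lemma gprod_inr_continuous : continuous gprod_inr.
Proof. by move=> h; exact: (cvg_pair (cvg_cst _) cvg_id). Qed.

Lemma gprod_fst_continuous : continuous gprod_fst.
Proof. by move=> [g h]; exact: (@cvg_fst _ _ (nbhs g) (nbhs h)). Qed.

Lemma gprod_snd_continuous : continuous gprod_snd.
Proof. by move=> [g h]; exact: (@cvg_snd _ _ (nbhs g) (nbhs h)). Qed.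

Lemma dual_fst_subproof (chi : dual R (gprod G H)) :
  continuous (dual_hom chi \o gprod_inl : G -> circle R).
Proof.
move=> g; apply: continuous_comp; first exact: gprod_inl_continuous.
exact: dual_continuous.
Qed.

Lemma dual_snd_subproof (chi : dual R (gprod G H)) :
  continuous (dual_hom chi \o gprod_inr : H -> circle R).
Proof.
move=> h; apply: continuous_comp; first exact: gprod_inr_continuous.
exact: dual_continuous.
Qed.

(** The projections of [dual R (gprod G H)] onto [dual R G] and [dual R H],
    under the identification [dual_prod] below. *)

Definition dual_fst (chi : dual R (gprod G H)) : dual R G :=
  Dual (@dual_fst_subproof chi).

Definition dual_snd (chi : dual R (gprod G H)) : dual R H :=
  Dual (@dual_snd_subproof chi).

Definition dual_prod (chi : dual R (gprod G H)) : dual R G * dual R H :=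
  (dual_fst chi, dual_snd chi).

Lemma dual_comp_fst_subproof (chi : dual R G) :
  continuous (dual_hom chi \o gprod_fst : gprod G H -> circle R).
Proof.
move=> x; apply: continuous_comp; first exact: gprod_fst_continuous.
exact: dual_continuous.
Qed.

Lemma dual_comp_snd_subproof (chi : dual R H) :
  continuous (dual_hom chi \o gprod_snd : gprod G H -> circle R).
Proof.
move=> x; apply: continuous_comp; first exact: gprod_snd_continuous.
exact: dual_continuous.
Qed.

Lemma dual_prod_bij : bijective dual_prod.
Proof.
exists (fun p => Dual (@dual_comp_fst_subproof p.1) +
                 Dual (@dual_comp_snd_subproof p.2)).
  move=> chi; apply: dual_ext => -[g h] /=.
  rewrite -[LHS]raddfD /=; congr (chi _).
  by congr pair; [exact: addr0|exact: add0r].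
move=> [chi psi]; congr pair; apply: dual_ext => x /=.
  by rewrite [X in _ + X](raddf0 psi) addr0.
by rewrite [X in X + _](raddf0 chi) add0r.
Qed.

End DualProduct.

Definition swallows (T : Type) (B A : set (set T)) :=
  forall S, A S -> exists2 S', B S' & S `<=` S'.

(* Main.v *)
From HB Require Import structures.
Require Import Defs.
From mathcomp Require Import all_boot all_order all_algebra.
From mathcomp Require Import all_classical all_reals topology normedtype.
From mathcomp Require Import complex lra.

(** The theorem follows from a description of Mackey groups by polars: a locally
    quasi-convex group [G] is Mackey iff every member of [Mac G] is
    equicontinuous.

    If [G] is Mackey and [K] is in [Mac G], the prepolars of the sets
    [(n)K + F], with [F] finite and containing [0], are the neighborhoods of [0]
    of a locally quasi-convex group topology ([uniform_topology]). All characters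
    in [dual R G] are continuous for it because [F] may contain them, and the
    last condition in the definition of [Mac] says that it has no other
    continuous characters, so it is compatible and hence coarser than the
    topology of [G]. As the prepolar of [K] is one of its neighborhoods of [0],
    [K] is equicontinuous ([mackey_equicontinuous]).

    Conversely let [nu] be a compatible locally quasi-convex topology and [V] a
    quasi-convex [nu]-neighborhood of [0]. The polar of [V] is in [Mac G]
    ([polar_Mac]): it is compact by Tychonoff's theorem, since a homomorphism
    that maps a neighborhood of [0] into the right half circle is continuous.
    So it is equicontinuous, which means that its prepolar, which is contained in
    [V], is a neighborhood of [0] in [G] ([equicontinuous_mackey]).

    For products, a set of characters of [G * H] is equicontinuous iff its two
    projections are ([equicontinuous_prod]), and [K * C] is in [Mac (G * H)] when
    [K] is in [Mac G] and [C] is in [Mac H] ([Mac_prod]). The latter, applied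
    with the polar of the whole group as second or first factor, transfers the
    Mackey property from [G * H] to [G] and [H]. Finally every equicontinuous set
    lies in a member of [Mac], namely the polar of its prepolar
    ([equicontinuous_sub_Mac]), which gives the swallowing property.

    All smallness arguments on the circle go through doubling: an element whose
    multiples by [1, 2, 4, ..., 2 ^ n] all have nonnegative real part is close to
    the identity when [n] is large ([nbhs0_circle_doubling]). *)

Set Implicit Arguments.
Unset Strict Implicit.
Unset Printing Implicit Defensive.

Import Order.TTheory GRing.Theory Num.Theory.
Import numFieldNormedType.Exports.

Local Open Scope classical_set_scope.
Local Open Scope ring_scope.

(** * Topology of the circle *)

Lemma nbhs_preimage (T U : topologicalType) (f : T -> U) (x : T) (A : set U) :
  {for x, continuous f} -> nbhs (f x) A -> nbhs x (f @^-1` A).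
Proof. by move=> cf nA; exact: cf. Qed.

Section CircleCoordinates.
Variable R : realType.
Implicit Types z w : circle R.

(** Cartesian coordinates on the circle. *)
Definition circle_re z : R := complex.Re (circle_val z).
Definition circle_im z : R := complex.Im (circle_val z).

Lemma circle_re0 : circle_re 0 = 1. Proof. by []. Qed.

Lemma circle_im0 : circle_im 0 = 0. Proof. by []. Qed.

Lemma circle_reD z w :
  circle_re (z + w) = circle_re z * circle_re w - circle_im z * circle_im w.
Proof.
rewrite /circle_re /circle_im /=.
by case: (circle_val z) => a b; case: (circle_val w).
Qed.

Lemma circle_sqr z : circle_re z ^+ 2 + circle_im z ^+ 2 = 1.
Proof.
have := circle_valP z; rewrite normc_def => /eqP /complexI.
rewrite -/(circle_re z) -/(circle_im z) => h.
by rewrite -[LHS]sqr_sqrtr ?addr_ge0 ?sqr_ge0// h expr1n.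
Qed.

Lemma circle_re_le1 z : circle_re z <= 1.
Proof.
have := circle_sqr z; move: (circle_re z) (circle_im z) => x y.
by have := sqr_ge0 y; nra.
Qed.

Lemma circle_ext z w :
  circle_re z = circle_re w -> circle_im z = circle_im w -> z = w.
Proof.
rewrite /circle_re /circle_im => h1 h2; apply: val_inj => /=.
by case: (circle_val z) (circle_val w) h1 h2 => a b [c d] /= -> ->.
Qed.

Lemma circle_reN z : circle_re (- z) = circle_re z.
Proof.
have := circle_reD (- z) z; have := circle_sqr z; have := circle_sqr (- z).
rewrite addNr circle_re0.
move: (circle_re (- z)) (circle_im (- z)) (circle_re z) (circle_im z).
move=> a b c d; have := sqr_ge0 (a - c); have := sqr_ge0 (b + d); nra.
Qed.

(** The topology of the circle in coordinates. *)
Lemma nbhs_circleP z (B : set (circle R)) :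
  nbhs z B <-> exists2 e : R, 0 < e & forall w,
    `|circle_re w - circle_re z| < e -> `|circle_im w - circle_im z| < e -> B w.
Proof.
have nE w : (`|circle_val z - circle_val w| : R[i]) =
    (Num.sqrt ((circle_re w - circle_re z) ^+ 2 +
               (circle_im w - circle_im z) ^+ 2))%:C%C.
  rewrite normc_def /circle_re /circle_im; congr (_%:C)%C; congr Num.sqrt.
  case: (circle_val z) (circle_val w) => a b [c d] /=.
  by rewrite -[in LHS](sqrrN (a - c)) -[in LHS](sqrrN (b - d)) !opprB.
split.
  rewrite nbhsE => -[O [[A oA <-] /= Az] OB].
  have /nbhs_ballP[[e e'] /=] : nbhs (circle_val z : R[i]^o) A.
    by apply: open_nbhs_nbhs.
  rewrite ltcE /= => /andP[/eqP -> e0] eA.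
  exists (e / 2); first by rewrite divr_gt0.
  move=> w h1 h2; apply: OB; apply: eA => /=.
  rewrite /ball /= nE ltcE /= eqxx /=.
  rewrite -[e]gtr0_norm// -sqrtr_sqr ltr_sqrt ?exprn_gt0//.
  rewrite -[X in X + _]real_normK ?num_real//.
  rewrite -[X in _ + X]real_normK ?num_real//.
  move: (normr_ge0 (circle_re w - circle_re z)) h1 e0.
  move: (normr_ge0 (circle_im w - circle_im z)) h2.
  by move: `|_ - _| `|_ - _| => x y; nra.
move=> [e e0 eB].
have e0C : 0 < (e%:C)%C :> R[i] by rewrite ltcE /= eqxx.
have h := nbhs_preimage (@circle_val_continuous R z)
  (nbhsx_ballx (circle_val z : R[i]^o) _ e0C).
apply: (filterS _ h) => w; rewrite /ball /= nE ltcE /= eqxx /= => hw.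
have s0 := sqrtr_ge0 ((circle_re w - circle_re z) ^+ 2 +
               (circle_im w - circle_im z) ^+ 2).
have s2 : Num.sqrt ((circle_re w - circle_re z) ^+ 2 +
               (circle_im w - circle_im z) ^+ 2) ^+ 2 < e ^+ 2.
  by rewrite ltr_pXn2r// nnegrE ltW.
rewrite sqr_sqrtr ?addr_ge0 ?sqr_ge0// in s2.
by apply: eB; rewrite -[e]gtr0_norm// -!sqrtr_sqr ltr_sqrt ?exprn_gt0//;
  move: s2 (sqr_ge0 (circle_re w - circle_re z))
    (sqr_ge0 (circle_im w - circle_im z)); lra.
Qed.

(** Near the identity the real part alone measures the distance, because
    [circle_im w ^+ 2 = 1 - circle_re w ^+ 2 <= 2 * (1 - circle_re w)]. *)
Lemma nbhs0_circleP (B : set (circle R)) :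
  nbhs 0 B <-> exists2 e : R, 0 < e & forall w, 1 - e < circle_re w -> B w.
Proof.
rewrite nbhs_circleP circle_re0 circle_im0; split=> -[e e0 eB]; last first.
  exists e => // w h _; apply: eB.
  by move: h; rewrite distrC ltr_norml => /andP[_]; lra.
pose d := Num.min e (e ^+ 2 / 2).
have d0 : 0 < d by rewrite lt_min e0 divr_gt0 ?exprn_gt0.
have [de de2] : d <= e /\ d <= e ^+ 2 / 2 by rewrite !ge_min !lexx orbT.
exists d => // w h; apply: eB.
  rewrite distrC ger0_norm ?subr_ge0 ?circle_re_le1//.
  by rewrite ltrBlDr addrC -ltrBlDr (le_lt_trans _ h)// lerB.
rewrite subr0 -[e]gtr0_norm// -!sqrtr_sqr ltr_sqrt ?exprn_gt0//.
have := circle_re_le1 w; have := circle_sqr w; move: h de2.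
by move: (circle_re w) (circle_im w) => x y; nra.
Qed.

Lemma circle_re_continuous : continuous circle_re.
Proof.
move=> z A /nbhs_ballP[e /= e0 eA]; apply/nbhs_circleP.
by exists e => // w h _; apply: eA; rewrite /ball /= distrC.
Qed.

Lemma circle_im_continuous : continuous circle_im.
Proof.
move=> z A /nbhs_ballP[e /= e0 eA]; apply/nbhs_circleP.
by exists e => // w _ h; apply: eA; rewrite /ball /= distrC.
Qed.

Lemma circle_hausdorff : hausdorff_space (circle R).
Proof.
move=> z w zw; apply: circle_ext; apply: (@Rhausdorff R) => A B nA nB.
  have [u [uA uB]] := zw _ _ (nbhs_preimage (@circle_re_continuous z) nA)
    (nbhs_preimage (@circle_re_continuous w) nB).
  by exists (circle_re u).
have [u [uA uB]] := zw _ _ (nbhs_preimage (@circle_im_continuous z) nA)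
  (nbhs_preimage (@circle_im_continuous w) nB).
by exists (circle_im u).
Qed.

End CircleCoordinates.

(** [K] is compact when [f] maps it onto a closed subset of a compact set and
    the topology of [X] is coarser than the one induced by [f]. *)
Lemma compact_embedding (X Y : topologicalType) (f : X -> Y) (K : set X)
    (L : set Y) :
  compact L -> f @` K `<=` L ->
  closure (f @` K) `<=` f @` K ->
  (forall x B, nbhs x B -> exists2 C, nbhs (f x) C & f @^-1` C `<=` B) ->
  compact K.
Proof.
move=> cL KL clK emb F PF FK.
have FI (A : set X) : F A -> fmap f F (f @` A).
  by move=> FA; apply: (filterS _ FA : F (f @^-1` _)) => a Aa; exists a.
have [|y [Ly Fy]] := cL (fmap f F).
  exact: filterS KL (FI _ FK).
have [x Kx xy] : (f @` K) y.
  by apply: clK => B nB; exact: (Fy (f @` K) B (FI _ FK) nB).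
exists x; split => // A B FA /emb[C nC CB].
rewrite xy in nC; have [_ [[a Aa <-] Ca]] := Fy (f @` A) C (FI _ FA) nC.
by exists a; split => //; apply: CB.
Qed.

Section CircleCompact.
Variable R : realType.

Lemma circle_compact : compact [set: circle R].
Proof.
pose f (z : circle R) : R * R := (circle_re z, circle_im z).
have bnd (a b : R) : a ^+ 2 + b ^+ 2 = 1 -> -1 <= a <= 1.
  by move=> h; apply/andP; split; nra.
apply: (@compact_embedding _ _ f _ (`[-1, 1] `*` `[-1, 1])).
- by apply: compact_setX; exact: segment_compact.
- move=> _ [z _ <-]; rewrite /f; split; rewrite /= in_itv/=.
    exact: bnd (circle_sqr z).
  by apply: (bnd _ (circle_re z)); rewrite addrC circle_sqr.
- pose n2 (p : R * R) : R := p.1 * p.1 + p.2 * p.2.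
  have cn2 : continuous n2.
    move=> p; apply: (@cvgD R R^o); apply: (@cvgM R);
      by [exact: cvg_fst|exact: cvg_snd].
  have cl : closed (n2 @^-1` [set 1]).
    apply: preimage_closed; first by move=> ? _; exact: cn2.
    exact/accessible_closed_set1/hausdorff_accessible/Rhausdorff.
  have sub : f @` setT `<=` n2 @^-1` [set 1].
    by move=> _ [z _ <-]; rewrite /= /n2/= -!expr2 circle_sqr.
  move=> [a b] /(closure_subset sub)/cl ab.
  have nab : `|a +i* b|%C == 1 :> R[i].
    by rewrite normc_def /= !expr2 [_ + _]ab sqrtr1.
  by exists (Circle nab).
- move=> z B /nbhs_circleP[e e0 eB].
  exists (ball (circle_re z) e `*` ball (circle_im z) e).
    by exists (ball (circle_re z) e, ball (circle_im z) e) => //; split;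
      exact: nbhsx_ballx.
  by move=> w [/= h1 h2]; apply: eB; rewrite distrC.
Qed.

Lemma circle_plusE (z : circle R) : circle_plus z = (0 <= circle_re z) :> Prop.
Proof. by []. Qed.

Lemma circle_plus_closed : closed (@circle_plus R).
Proof.
rewrite (_ : @circle_plus R = @circle_re R @^-1` [set x | 0 <= x])//.
apply: preimage_closed; last exact: closed_ge.
by move=> ? _; exact: circle_re_continuous.
Qed.

Lemma circle_plus0 : @circle_plus R 0. Proof. exact: ler01. Qed.

Lemma nbhs0_circle_plus : nbhs 0 (@circle_plus R).
Proof.
apply/nbhs0_circleP; exists 1 => // w; rewrite subrr => h; exact: ltW.
Qed.

Lemma circle_plusN (z : circle R) : circle_plus (- z) <-> circle_plus z.
Proof. by rewrite !circle_plusE circle_reN. Qed.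

(** Elements [z] such that [z] and [z *+ 2] lie in [circle_plus] have argument
    at most a quarter of [pi], so that two of them add up inside [circle_plus]. *)
Lemma circle_plusD (z w : circle R) :
  circle_plus z -> circle_plus (z + z) -> circle_plus w -> circle_plus (w + w) ->
  circle_plus (z + w).
Proof.
rewrite !circle_plusE !circle_reD.
move: (circle_re z) (circle_im z) (circle_re w) (circle_im w) => a c b d.
move=> a0 ac b0 bd.
have ca : `|c| <= a by rewrite -[a]ger0_norm// -!sqrtr_sqr ler_sqrt; nra.
have db : `|d| <= b by rewrite -[b]ger0_norm// -!sqrtr_sqr ler_sqrt; nra.
rewrite subr_ge0 (le_trans (ler_norm _))// normrM.
exact: ler_pM.
Qed.

(** As long as the doublings stay in [circle_plus], each of them at least
    doubles the distance [1 - circle_re z] to the identity. *)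
Lemma circle_re_doubling (z : circle R) n :
  (forall k, (k <= n)%N -> circle_plus (z *+ (2 ^ k))) ->
  (1 - circle_re z) * 2 ^+ n <= 1.
Proof.
move=> h; suff : (1 - circle_re z) * 2 ^+ n <= 1 - circle_re (z *+ (2 ^ n)).
  have := h n (leqnn n); rewrite circle_plusE.
  by move: (circle_re _) (_ * _) => a b; lra.
elim: n h => [|n IHn] h; first by rewrite expr0 mulr1 expn0 mulr1n.
have {}IHn := IHn (fun k kn => h k (leqW kn)).
have h0 : 0 <= circle_re (z *+ 2 ^ n) by apply: h.
rewrite exprS mulrCA expnS mulnC mulrnA mulr2n circle_reD.
set y := z *+ 2 ^ n in h0 IHn *.
have := circle_sqr y; have := circle_re_le1 y; move: IHn h0.
move: (circle_re y) (circle_im y) (_ * 2 ^+ n) => a b c; nra.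
Qed.

(** A quantitative form of the absence of small subgroups in the circle. *)
Lemma nbhs0_circle_doubling (V : set (circle R)) : nbhs 0 V ->
  exists n, forall z : circle R,
    (forall k, (k <= n)%N -> circle_plus (z *+ (2 ^ k))) -> V z.
Proof.
move=> /nbhs0_circleP[e e0 eV].
have [n hn] : exists n, e^-1 < 2 ^+ n.
  exists (Num.bound e^-1).
  apply: (@lt_le_trans _ _ (Num.bound e^-1)%:R).
    by apply: archi_boundP; rewrite invr_ge0 ltW.
  by rewrite -natrX ler_nat ltnW// ltn_expl.
exists n => z /circle_re_doubling h; apply: eV.
have p0 : 0 < 2 ^+ n :> R by rewrite exprn_gt0.
have : 1 < e * 2 ^+ n by rewrite -ltr_pdivrMl// mulr1.
by nra.
Qed.

End CircleCompact.

(** * Continuity and closures *)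

Lemma continuous_subr (T : topologicalType) (S : topologicalZmodType)
    (f g : T -> S) :
  continuous f -> continuous g -> continuous (fun x => f x - g x).
Proof.
move=> cf cg x; apply: (@continuous_comp _ _ _ (fun x => (f x, g x))
  (fun z : S * S => z.1 - z.2)); last exact: sub_continuous.
exact: (cvg_pair (cf x) (cg x)).
Qed.

Lemma closure_subset_preimage (X Y : topologicalType) (f : X -> Y) (S : set X)
    (D : set Y) :
  continuous f -> closed D -> S `<=` f @^-1` D -> closure S `<=` f @^-1` D.
Proof.
move=> cf cD SD; have c : closed (f @^-1` D).
  by apply: preimage_closed => // ? _; exact: cf.
by move=> x /(closure_subset SD); exact: c.
Qed.

(** Neighborhoods for an initial topology come from the codomain; this is the
    embedding hypothesis of [compact_embedding]. *)
Lemma nbhs_initial (S : choiceType) (T : topologicalType) (f : S -> T)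
    (x : initial_topology f) (B : set (initial_topology f)) :
  nbhs x B -> exists2 C, nbhs (f x) C & f @^-1` C `<=` B.
Proof.
rewrite [nbhs x]nbhsE => -[O [[A oA <-] /= Ax] OB].
exists A => //; exact: open_nbhs_nbhs.
Qed.

Lemma nbhs_translate (T : topologicalZmodType) (x : T) (A : set T) :
  nbhs x A <-> nbhs 0 [set g | A (x + g)].
Proof.
have ct (y : T) : continuous (fun g => y + g).
  move=> g; apply: (@continuous_comp _ _ _ (fun g => (y, g))
    (fun z : T * T => z.1 + z.2)); last exact: add_continuous.
  exact: (cvg_pair (cvg_cst _) cvg_id).
split=> nA; first by apply: (nbhs_preimage (@ct x 0)); rewrite addr0.
have := @nbhs_preimage _ _ _ x _ (@ct (- x) x).
rewrite addNr => /(_ _ nA); apply: filterS => y /=.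
by rewrite addrA subrr add0r.
Qed.

Lemma additive_continuous (T S : topologicalZmodType) (f : {additive T -> S}) :
  (forall V, nbhs 0 V -> nbhs 0 (f @^-1` V)) -> continuous f.
Proof.
move=> h x A /nbhs_translate/h nA; apply/nbhs_translate.
by apply: filterS nA => g /=; rewrite raddfD.
Qed.

(** * Equicontinuity and polars *)

(** The part of a group topology that matters for polars: a filter, to be
    thought of as the neighborhoods of [0], that is stable under taking
    preimages by [g |-> g + g]. *)
Definition doubling_closed (G : zmodType) (N : set_system G) :=
  forall A, N A -> N [set g | A (g + g)].

Lemma nbhs0_doubling_closed (T : topologicalZmodType) :
  doubling_closed (nbhs (0 : T)).
Proof.
move=> A nA; have := @nbhs_preimage _ _ (fun g : T => g + g) 0 A.
apply; last by rewrite addr0.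
apply: (@continuous_comp _ _ _ (fun g => (g, g))
    (fun z : T * T => z.1 + z.2)); last exact: add_continuous.
exact: (cvg_pair cvg_id cvg_id).
Qed.

Section Doubling.
Variables (R : realType) (G : zmodType) (N : set_system G).
Hypotheses (FN : Filter N) (dN : doubling_closed N).

Lemma doubling_closed_pow A n :
  N A -> N [set g | forall k, (k <= n)%N -> A (g *+ (2 ^ k))].
Proof.
move=> NA; have Nk k : N [set g | A (g *+ (2 ^ k))].
  elim: k => [|k IHk]; first by rewrite expn0; under eq_set do rewrite mulr1n.
  apply: filterS (dN IHk) => g /=.
  by rewrite -mulr2n -mulrnA expnS.
elim: n => [|n IHn].
  by apply: filterS (Nk 0%N) => g /= Ag k; rewrite leqn0 => /eqP ->.
apply: filterS2 IHn (Nk n.+1) => g /= h Ag k.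
by rewrite leq_eqVlt => /predU1P[->//|]; rewrite ltnS; exact: h.
Qed.

(** A family of characters that maps a neighborhood of [0] into the right half
    circle maps neighborhoods of [0] into arbitrarily small ones. *)
Lemma circle_plus_small (J : Type) (D : set J)
    (f : J -> {additive G -> circle R}) :
  N [set g | forall j, D j -> circle_plus (f j g)] ->
  forall V, nbhs 0 V -> N [set g | forall j, D j -> V (f j g)].
Proof.
move=> Nf V /nbhs0_circle_doubling[n hn].
apply: filterS (doubling_closed_pow n Nf) => g h j Dj; apply: hn => k kn.
by rewrite -raddfMn; exact: h.
Qed.

End Doubling.

Section Equicontinuity.
Variables (R : realType) (G : topologicalZmodType).

Lemma character_continuous (f : {additive G -> circle R}) :
  nbhs 0 (f @^-1` @circle_plus R) -> continuous f.
Proof.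
move=> nf; apply: additive_continuous => V nV.
have nfT : nbhs 0 [set g | forall u : unit, setT u -> circle_plus (f g)].
  by apply: filterS nf => g fg _ _.
have := circle_plus_small (nbhs_filter 0) (@nbhs0_doubling_closed G) nfT nV.
by apply: filterS => g /(_ tt I).
Qed.

(** Equicontinuity only has to be tested on the right half circle. *)
Lemma equicontinuous_prepolar (K : set (dual R G)) :
  equicontinuous_dual K <-> nbhs 0 (prepolar K).
Proof.
split=> [/(_ _ (nbhs0_circle_plus R))[U nU KU]|nK V nV].
  by apply: filterS nU => g Ug chi Kchi; apply: (KU chi) => //; exists g.
exists [set g | forall chi, K chi -> V (chi g)].
  exact: (circle_plus_small _ (@nbhs0_doubling_closed G) nK nV).
by move=> chi Kchi _ [g h <-]; exact: h.
Qed.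

Lemma sub_prepolar (K C : set (dual R G)) :
  K `<=` C -> prepolar C `<=` prepolar K.
Proof. by move=> KC g h chi /KC; exact: h. Qed.

Lemma equicontinuous_sub (K C : set (dual R G)) :
  K `<=` C -> equicontinuous_dual C -> equicontinuous_dual K.
Proof.
rewrite !equicontinuous_prepolar => KC; apply: filterS; exact: sub_prepolar.
Qed.

Variable N : set_system G.
Hypotheses (FN : Filter N) (dN : doubling_closed N).
Implicit Types A B : set (dual R G).

Lemma prepolar_sumset A B :
  N (prepolar A) -> N (prepolar B) -> N (prepolar (sumset A B)).
Proof.
move=> NA NB; have NAB : N (prepolar A `&` prepolar B) by exact: filterI.
apply: filterS2 NAB (dN NAB) => g [Ag Bg] [Agg Bgg] _ [a Aa [b Bb <-]].
apply: circle_plusD; [exact: Ag| |exact: Bg|].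
  by rewrite -raddfD; exact: Agg.
by rewrite -raddfD; exact: Bgg.
Qed.

Lemma prepolar_nfold n A : N (prepolar A) -> N (prepolar (nfold n A)).
Proof.
rewrite /nfold; elim: n.-1 => //= m IHm NA.
by apply: prepolar_sumset => //; exact: IHm.
Qed.

Lemma prepolar_finite A : finite_set A ->
  (forall chi, A chi -> N (chi @^-1` @circle_plus R)) -> N (prepolar A).
Proof.
move=> /finite_fsetP[X ->] h.
apply: (filterS _ (filter_bigI (D := X)
  (f := fun chi : dual R G => chi @^-1` @circle_plus R) _ h)).
by move=> g hg chi Xchi; exact: hg.
Qed.

End Equicontinuity.

(** * Polars of neighborhoods belong to Mac *)

Section PolarMac.
Variables (R : realType) (G : topologicalZmodType).

(** Evaluation at [g], a continuous character of [dual R G]. *)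
Definition dual_eval (g : G) (chi : dual R G) : circle R := chi g.

Lemma dual_eval_is_additive g : zmod_morphism (dual_eval g).
Proof. by []. Qed.

HB.instance Definition _ g := GRing.isZmodMorphism.Build (dual R G) (circle R)
  (dual_eval g) (dual_eval_is_additive g).

Lemma polar_quasi_convex (U : set G) :
  quasi_convex R (polar U : set (dual R G)).
Proof.
move=> chi nUchi.
have [g Ug ng] : exists2 g, U g & ~ circle_plus (chi g).
  apply: contrapT => h; apply: nUchi => _ [g Ug <-].
  by apply: contrapT => ng; apply: h; exists g.
exists (Dual (@dual_eval_continuous R G g : continuous (dual_eval g))) => //.
by move=> _ [psi Upsi <-]; apply: Upsi; exists g.
Qed.

(** The algebraic polar is closed in the compact group of all maps to the
    circle; when it consists of continuous characters this gives compactness. *)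
Lemma polar_compact (U : set G) :
  algebraic_polar U `<=` [set chi : {additive G -> circle R} |
    continuous (chi : G -> circle R)] ->
  compact (polar U : set (dual R G)).
Proof.
move=> Uc; apply: (@compact_embedding _ _ (@dual_fun R G) _ setT) => //.
- have := @tychonoff G (fun=> circle R) (fun=> setT) (fun=> @circle_compact R).
  by congr compact; apply/seteqP; split.
- move=> phi clphi.
  have ev g : continuous (fun psi : {ptws G -> circle R} => psi g).
    exact: (@proj_continuous _ (fun=> circle R) g).
  have phiB : zmod_morphism phi.
    move=> x y; apply/eqP; rewrite -subr_eq0; apply/eqP.
    apply: (closure_subset_preimage
      (f := fun psi : {ptws G -> circle R} => psi (x - y) - (psi x - psi y))
      (D := [set 0]) _ _ _ clphi).
    + by do 2?apply: continuous_subr.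
    + exact/accessible_closed_set1/hausdorff_accessible/circle_hausdorff.
    + by move=> _ [chi _ <-]; rewrite /= /dual_fun raddfB subrr.
  pose phiZ := GRing.isZmodMorphism.Build _ _ phi phiB.
  pose phiA : {additive G -> circle R} := HB.pack phi phiZ.
  have Uphi : algebraic_polar U phiA.
    move=> _ [g Ug <-].
    apply: (closure_subset_preimage (ev g) (@circle_plus_closed R) _ clphi).
    by move=> _ [chi Uchi <-]; apply: Uchi; exists g.
  by exists (Dual (Uc _ Uphi)).
- by move=> chi B /nbhs_initial.
Qed.

(** [polar U] is in [Mac] as soon as [U] is a neighborhood of [0] for some
    notion [N] of neighborhood that has the same continuous characters. *)
Lemma polar_Mac (N : set_system G) (U : set G) :
  Filter N -> doubling_closed N ->
  (forall chi : dual R G, N (chi @^-1` @circle_plus R)) ->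
  (forall A, N A -> algebraic_polar A `<=`
    [set chi : {additive G -> circle R} | continuous (chi : G -> circle R)]) ->
  N U -> Mac (polar U : set (dual R G)).
Proof.
move=> FN dN Nchi Nc NU; split.
- exact: polar_quasi_convex.
- exact/polar_compact/Nc.
- move=> F n finF _ _; apply: Nc; apply: prepolar_sumset => //.
    apply: prepolar_nfold => //; apply: filterS NU => g Ug chi; apply.
    by exists g.
  by apply: prepolar_finite.
Qed.

End PolarMac.

(** * The group topology with given neighborhoods of zero *)

Section TopologyOfNeighborhoods.
Variables (G : zmodType) (N : set_system G).
Hypotheses (FN : Filter N) (N0 : forall A, N A -> A 0)
  (Nsub : forall A, N A ->
    exists2 B, N B & forall v w, B v -> B w -> A (v - w)).

(** A set is open when its translate by [- x] belongs to [N] for each of its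
    points [x]. *)
Definition N_open : set_system G :=
  [set U | forall x, U x -> N [set g | U (x + g)]].

(** The interior of [A] for the topology whose open sets are [N_open]. *)
Definition N_interior (A : set G) : set G := [set v | N [set g | A (v + g)]].

Lemma N_interior_sub A : N_interior A `<=` A.
Proof. by move=> v /N0; rewrite /= addr0. Qed.

Lemma N_interior_open A : N_open (N_interior A).
Proof.
move=> v /Nsub[B /[dup] NB /Nsub[C NC CB] BA].
have C0 := N0 NC.
(* [h + g] is the difference of [h = h - 0] and [- g = 0 - g], both in [B]. *)
apply: filterS (NC) => h Ch; apply: filterS NC => g Cg /=; rewrite -addrA.
rewrite -[g]opprK; apply: BA; first by rewrite -[h]subr0; exact: CB.
by rewrite -[- g]sub0r; exact: CB.
Qed.

Lemma N_openT : N_open setT.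
Proof. by move=> x _; exact: filterT. Qed.

Lemma N_openI : setI_closed N_open.
Proof. by move=> U V oU oV x [/oU NU /oV]; exact: filterI. Qed.

Lemma N_open_bigcup (I : Type) (f : I -> set G) :
  (forall i, N_open (f i)) -> N_open (\bigcup_i f i).
Proof. by move=> fo x [i _ /fo]; apply: filterS => g fig; exists i. Qed.

Lemma N_sub_continuous (x y : G) (U : set G) : N_open U -> U (x - y) ->
  exists V W : set G, [/\ N_open V, N_open W, V x, W y &
    forall v w, V v -> W w -> U (v - w)].
Proof.
move=> oU /oU/Nsub[B NB BU].
exists (N_interior [set g | B (g - x)]), (N_interior [set g | B (g - y)]).
split; [exact: N_interior_open|exact: N_interior_open| | |].
- by apply: filterS NB => g Bg; rewrite /= addrC addKr.
- by apply: filterS NB => g Bg; rewrite /= addrC addKr.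
- move=> v w /N_interior_sub Bv /N_interior_sub Bw.
  have := BU _ _ Bv Bw; congr U.
  by rewrite opprB addrACA (addrC x) subrK addKr.
Qed.

(** A filter that satisfies the axioms of the neighborhoods of [0] of a group
    topology generates one. *)
Definition topology_of_neighborhoods : group_topology G :=
  GroupTopology N_openT N_openI N_open_bigcup N_sub_continuous.

Lemma nbhs0_topology_of_neighborhoods (A : set G) :
  nbhs (0 : retop topology_of_neighborhoods) A <-> N A.
Proof.
split.
  rewrite nbhsE => -[U [oU U0] UA].
  have : N [set g | U (0 + g)] by exact: oU.
  by apply: filterS => g; rewrite /= add0r; exact: UA.
move=> NA; rewrite nbhsE; exists (N_interior A); last exact: N_interior_sub.
split; first exact: N_interior_open.
by rewrite /N_interior /=; under eq_set do rewrite add0r.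
Qed.

End TopologyOfNeighborhoods.

(** * Multiples of sets and quasi-convexity *)

Section NFold.
Variable V : zmodType.
Implicit Types A B : set V.

Lemma nfold_add A n m a b :
  nfold n.+1 A a -> nfold m.+1 A b -> nfold (n + m).+2 A (a + b).
Proof.
elim: m b => [|m IHm] b Aa.
  by move=> Ab; rewrite addn0; exists a => //; exists b.
move=> [c Ac [d Ad <-]]; rewrite addrA addnS.
by exists (a + c); [exact: IHm|exists d].
Qed.

Lemma nfold_le A n m : A 0 -> (n <= m)%N -> nfold n.+1 A `<=` nfold m.+1 A.
Proof.
move=> A0 /subnK <-; elim: (m - n)%N => //= k IHk a /IHk Aa.
by rewrite addSn; exists a => //; exists 0 => //; rewrite addr0.
Qed.

Lemma sumsetS A A' B B' :
  A `<=` A' -> B `<=` B' -> sumset A B `<=` sumset A' B'.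
Proof. by move=> AA BB _ [a /AA ? [b /BB ? <-]]; exists a => //; exists b. Qed.

(** The form in which [circle_plusD] is fed: a set that contains both [x] and
    [x + x] for every [x] in [(n)A + B]. *)
Lemma nfold_sumset_double A B n x : A 0 -> B 0 ->
  sumset (nfold n.+1 A) B x ->
  sumset (nfold (n + n).+2 A) (sumset B B) x /\
  sumset (nfold (n + n).+2 A) (sumset B B) (x + x).
Proof.
move=> A0 B0 [a Aa [b Bb <-]]; split.
  exists a; first by apply: nfold_le Aa => //; rewrite leqW// leq_addr.
  by exists b => //; exists b => //; exists 0 => //; rewrite addr0.
rewrite addrACA; exists (a + a); first exact: nfold_add.
by exists (b + b) => //; exists b => //; exists b.
Qed.

Lemma nfold_additive (W : zmodType) (f : {additive V -> W}) A (B : set W) n :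
  f @` A `<=` B -> f @` nfold n A `<=` nfold n B.
Proof.
move=> AB; rewrite /nfold; elim: n.-1 => //= m IHm _ [_ [a Aa [b Ab <-]] <-].
rewrite raddfD; exists (f a); first by apply: IHm; exists a.
by exists (f b) => //; apply: AB; exists b.
Qed.

End NFold.

Section QuasiConvex.
Variables (R : realType) (G : topologicalZmodType).

Lemma quasi_convex0 (A : set G) : quasi_convex R A -> A 0.
Proof.
move=> qA; apply: contrapT => /qA[chi _]; apply.
by rewrite raddf0; exact: circle_plus0.
Qed.

Lemma hausdorff_separating :
  (forall g : G, (forall chi : dual R G, chi g = 0) -> g = 0) ->
  hausdorff_space G.
Proof.
move=> sep p q pq; apply/eqP; rewrite -subr_eq0; apply/eqP/sep => chi.
rewrite raddfB; apply/eqP; rewrite subr_eq0; apply/eqP/circle_hausdorff.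
move=> A B nA nB; have c := @dual_continuous R G chi.
have [g [Ag Bg]] := pq _ _ (nbhs_preimage (c p) nA) (nbhs_preimage (c q) nB).
by exists (chi g).
Qed.

Lemma dual_separating (g : G) : locally_quasi_convex R G ->
  (forall chi : dual R G, chi g = 0) -> g = 0.
Proof.
move=> [hG qG] g0; apply/esym/hG => A B nA nB.
have [V [nV qV VA]] := qG _ nA.
exists g; split; last exact: nbhs_singleton.
apply: VA; apply: contrapT => /qV[chi _]; apply; rewrite g0.
exact: circle_plus0.
Qed.

End QuasiConvex.

(** * Mackey groups and equicontinuity of Mac *)

Section Mackey.
Variables (R : realType) (G : topologicalZmodType).
Implicit Types K : set (dual R G).

(** The neighborhoods of [0] for the topology of uniform convergence on the
    sets [(n)K + F], with [F] finite and containing [0]; the index [p.1] stands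
    for [n - 1], which keeps [n] positive. *)
Definition uniform_nbhs K : set_system G :=
  filter_from [set p : nat * set (dual R G) | finite_set p.2 /\ p.2 0]
    (fun p => prepolar (sumset (nfold p.1.+1 K) p.2)).

Section UniformTopology.
Variable K : set (dual R G).
Hypothesis K0 : K 0.

Lemma uniform_nbhs_filter : Filter (uniform_nbhs K).
Proof.
apply: filter_from_filter.
  by exists (0%N, [set 0]); split => //; exact: finite_set1.
move=> [n E] [m F] [/= fE E0] [/= fF F0].
exists (maxn n m, E `|` F).
  by split; [rewrite /= finite_setU|left].
by move=> g h; split; apply: sub_prepolar h; apply: sumsetS;
  rewrite /= ?(@subsetUl _ E F) ?(@subsetUr _ E F)//; apply: nfold_le => //;
  rewrite ?leq_maxl ?leq_maxr.
Qed.

Lemma uniform_nbhs0 A : uniform_nbhs K A -> A 0.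
Proof.
move=> [p _]; apply => chi _; rewrite raddf0; exact: circle_plus0.
Qed.

Lemma uniform_nbhs_sub A : uniform_nbhs K A ->
  exists2 B, uniform_nbhs K B & forall v w, B v -> B w -> A (v - w).
Proof.
move=> [[n F] [/= finF F0] UA].
exists (prepolar (sumset (nfold (n + n).+2 K) (sumset F F))).
  exists ((n + n).+1, sumset F F) => //; split => /=.
    exact: finite_image2.
  by exists 0 => //; exists 0 => //; rewrite addr0.
move=> v w Bv Bw; apply: UA => chi /(nfold_sumset_double K0 F0)[h1 h2].
rewrite raddfB; apply: circle_plusD; [exact: Bv|exact: (Bv _ h2)| |].
  by rewrite circle_plusN; exact: Bw.
by rewrite -opprD circle_plusN; exact: (Bw _ h2).
Qed.

(** The topology of uniform convergence on the sets [(n)K + F]. *)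
Definition uniform_topology : group_topology G :=
  topology_of_neighborhoods uniform_nbhs_filter uniform_nbhs0 uniform_nbhs_sub.

Lemma nbhs0_uniform A :
  nbhs (0 : retop uniform_topology) A <-> uniform_nbhs K A.
Proof. exact: nbhs0_topology_of_neighborhoods. Qed.

Lemma uniform_dual_continuous (chi : dual R G) :
  continuous (chi : retop uniform_topology -> circle R).
Proof.
apply: (@character_continuous R (retop uniform_topology) (dual_hom chi)).
apply/nbhs0_uniform; exists (0%N, [set 0; chi]).
  by split => /=; [exact: finite_set2|left].
move=> g; apply; exists 0 => //; exists chi; first by right.
by rewrite add0r.
Qed.

Lemma uniform_locally_quasi_convex : locally_quasi_convex R G ->
  locally_quasi_convex R (retop uniform_topology).
Proof.
move=> lqcG; split.
  apply: (@hausdorff_separating R) => g g0; apply: (dual_separating lqcG) => chi.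
  exact: (g0 (@Dual R (retop uniform_topology) (dual_hom chi)
    (@uniform_dual_continuous chi))).
move=> U /nbhs0_uniform[[n F] nF UF].
exists (prepolar (sumset (nfold n.+1 K) F)); split => //.
  by apply/nbhs0_uniform; exists (n, F).
move=> g /existsNP[chi /not_implyP[Bchi nchig]].
exists (@Dual R (retop uniform_topology) (dual_hom chi)
    (@uniform_dual_continuous chi)) => //.
by move=> _ [h Bh <-]; exact: Bh.
Qed.

(** This is where the third condition in the definition of [Mac] is used. *)
Lemma uniform_compatible : Mac K -> compatible R uniform_topology.
Proof.
move=> [_ _ MK]; apply/seteqP; split=> chi /= cchi.
  exact: (@uniform_dual_continuous (Dual cchi)).
have : nbhs (0 : retop uniform_topology) (chi @^-1` @circle_plus R).
  apply: (@nbhs_preimage (retop uniform_topology) _ chi 0); first exact: cchi.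
  by rewrite raddf0; exact: nbhs0_circle_plus.
move=> /nbhs0_uniform[[n F] [/= finF F0] FU].
by apply: (MK F n.+1) => // _ [g Fg <-]; exact: FU.
Qed.

End UniformTopology.

(** In a Mackey group the members of [Mac] are equicontinuous, by comparison with
    [uniform_topology]. *)
Lemma mackey_equicontinuous K : mackey R G -> Mac K -> equicontinuous_dual K.
Proof.
move=> [lqcG GM] MK; have [qK _ _] := MK; have K0 := quasi_convex0 qK.
have oU := GM _ (uniform_locally_quasi_convex K0 lqcG) (uniform_compatible K0 MK).
have : nbhs (0 : retop (uniform_topology K0)) (prepolar K).
  apply/nbhs0_uniform; exists (0%N, [set 0]).
    by split => //=; exact: finite_set1.
  apply: sub_prepolar => chi Kchi; exists chi => //; exists 0 => //.
  by rewrite addr0.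
rewrite nbhsE => -[U [/oU openU U0] UK].
apply/equicontinuous_prepolar; apply: filterS UK _.
exact: open_nbhs_nbhs.
Qed.

(** Conversely, equicontinuity of the members of [Mac] suffices: it is applied to
    the polars of the quasi-convex neighborhoods of a compatible topology. *)
Lemma equicontinuous_mackey : locally_quasi_convex R G ->
  (forall K, Mac K -> equicontinuous_dual K) -> mackey R G.
Proof.
move=> lqcG eqG; split => // nu [_ lqcnu] cnu O oO.
have cnuE (chi : {additive G -> circle R}) : continuous (chi : G -> circle R) <->
    continuous (chi : retop nu -> circle R).
  by move/seteqP: cnu => [c1 c2]; split => [/c1|/c2].
rewrite openE => x Ox; apply/nbhs_translate.
have : nbhs (x : retop nu) O by apply: open_nbhs_nbhs.
move=> /nbhs_translate/lqcnu[V [nV qV VO]].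
have MV : Mac (@polar R G V).
  apply: (@polar_Mac R G (nbhs (0 : retop nu))) => //.
  - exact: (@nbhs0_doubling_closed (retop nu)).
  - move=> chi; apply: (@nbhs_preimage (retop nu) _ chi 0).
      by have /cnuE := @dual_continuous _ _ chi; exact.
    by rewrite raddf0; exact: nbhs0_circle_plus.
  - move=> A nA chi Achi; apply/cnuE.
    apply: (@character_continuous R (retop nu) chi).
    by apply: filterS nA => g Ag; apply: Achi; exists g.
have := eqG _ MV; rewrite equicontinuous_prepolar; apply: filterS => g Vg.
apply: VO; apply: contrapT => /qV[chi Vchi]; apply.
have cchi : continuous (dual_hom chi : G -> circle R).
  by apply/(cnuE (dual_hom chi)); exact: dual_continuous.
exact: (Vg (@Dual R G (dual_hom chi) cchi)).
Qed.

End Mackey.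

(** * Products *)

(** Continuity into the topology of pointwise convergence. *)
Lemma continuous_to_dual (R : realType) (G : topologicalZmodType)
    (T : topologicalType) (f : T -> dual R G) :
  (forall g, continuous (fun x => f x g)) -> continuous f.
Proof.
move=> cf; apply: (@continuous_comp_initial _ _ _ (@dual_fun R G)) => x.
apply/cvg_sup => g.
apply: (@continuous_comp_initial _ _ _ (fun h : G -> circle R => h g)) => {}x.
exact: cf.
Qed.

Section DualOfProduct.
Variables (R : realType) (G H : topologicalZmodType).

(** The inclusions of the two dual groups in the dual of the product. *)
Definition dual_inl (chi : dual R G) : dual R (gprod G H) :=
  Dual (@dual_comp_fst_subproof R G H chi).

Definition dual_inr (chi : dual R H) : dual R (gprod G H) :=
  Dual (@dual_comp_snd_subproof R G H chi).

Lemma gprodE (x : gprod G H) : x = gprod_inl H x.1 + gprod_inr G x.2.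
Proof. by case: x => g h; congr pair; rewrite /= ?addr0 ?add0r. Qed.

Lemma dual_prodE (chi : dual R (gprod G H)) :
  dual_inl (dual_fst chi) + dual_inr (dual_snd chi) = chi.
Proof. by apply: dual_ext => x; rewrite [in RHS](gprodE x) raddfD. Qed.

Lemma dual_inlK : cancel dual_inl (@dual_fst R G H).
Proof. by move=> chi; exact: dual_ext. Qed.

Lemma dual_inrK : cancel dual_inr (@dual_snd R G H).
Proof. by move=> chi; exact: dual_ext. Qed.

Lemma dual_fst_inr chi : dual_fst (dual_inr chi) = 0.
Proof. by apply: dual_ext => g; exact: raddf0. Qed.

Lemma dual_snd_inl chi : dual_snd (dual_inl chi) = 0.
Proof. by apply: dual_ext => g; exact: raddf0. Qed.

Lemma dual_fst_is_additive : zmod_morphism (@dual_fst R G H).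
Proof. by move=> chi psi; exact: dual_ext. Qed.

Lemma dual_snd_is_additive : zmod_morphism (@dual_snd R G H).
Proof. by move=> chi psi; exact: dual_ext. Qed.

HB.instance Definition _ := GRing.isZmodMorphism.Build
  (dual R (gprod G H)) (dual R G) (@dual_fst R G H) dual_fst_is_additive.
HB.instance Definition _ := GRing.isZmodMorphism.Build
  (dual R (gprod G H)) (dual R H) (@dual_snd R G H) dual_snd_is_additive.

Lemma dual_fst_continuous : continuous (@dual_fst R G H).
Proof. by apply: continuous_to_dual => g; exact: dual_eval_continuous. Qed.

Lemma dual_snd_continuous : continuous (@dual_snd R G H).
Proof. by apply: continuous_to_dual => g; exact: dual_eval_continuous. Qed.

Lemma dual_inl_continuous : continuous dual_inl.
Proof. by apply: continuous_to_dual => g; exact: dual_eval_continuous. Qed.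

Lemma dual_inr_continuous : continuous dual_inr.
Proof. by apply: continuous_to_dual => g; exact: dual_eval_continuous. Qed.

Lemma gprod_additive_continuous (f : {additive gprod G H -> circle R}) :
  continuous (f \o @gprod_inl G H : G -> circle R) ->
  continuous (f \o @gprod_inr G H : H -> circle R) ->
  continuous (f : gprod G H -> circle R).
Proof.
move=> c1 c2; pose chi := dual_inl (Dual c1) + dual_inr (Dual c2).
have -> : (f : gprod G H -> circle R) = chi.
  by apply/funext => x; rewrite [in LHS](gprodE x) raddfD.
exact: dual_continuous.
Qed.

Lemma gprod_locally_quasi_convex :
  locally_quasi_convex R G -> locally_quasi_convex R H ->
  locally_quasi_convex R (gprod G H).
Proof.
move=> lqcG lqcH; split.
  apply: (@hausdorff_separating R) => -[g h] gh0; congr pair.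
    by apply: (dual_separating lqcG) => chi; exact: (gh0 (dual_inl chi)).
  by apply: (dual_separating lqcH) => chi; exact: (gh0 (dual_inr chi)).
move=> U [[A B] /= [nA nB] ABU].
have [[_ /(_ _ nA)[V [nV qV VA]]] [_ /(_ _ nB)[W [nW qW WB]]]] := (lqcG, lqcH).
exists (V `*` W); split.
- by exists (V, W).
- move=> [g h] /not_andP[/qV[chi Vchi ng]|/qW[chi Wchi nh]].
    exists (dual_inl chi) => // _ [x [Vx _] <-].
    by apply: Vchi; exists x.1.
  exists (dual_inr chi) => // _ [x [_ Wx] <-].
  by apply: Wchi; exists x.2.
- by move=> x [/VA Ax /WB Bx]; exact: ABU.
Qed.

Lemma equicontinuous_prod (S : set (dual R (gprod G H))) :
  equicontinuous_dual S <->
  equicontinuous_dual (@dual_fst R G H @` S) /\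
  equicontinuous_dual (@dual_snd R G H @` S).
Proof.
split=> [/equicontinuous_prepolar nS|].
  split; apply/equicontinuous_prepolar.
    apply: filterS (nbhs_preimage (@gprod_inl_continuous G H 0) nS).
    by move=> g Sg _ [chi Schi <-]; exact: Sg.
  apply: filterS (nbhs_preimage (@gprod_inr_continuous G H 0) nS).
  by move=> g Sg _ [chi Schi <-]; exact: Sg.
move=> [/equicontinuous_prepolar n1 /equicontinuous_prepolar n2].
apply/equicontinuous_prepolar.
have : nbhs (0 : gprod G H) (prepolar (sumset
    (dual_inl @` (@dual_fst R G H @` S)) (dual_inr @` (@dual_snd R G H @` S)))).
  apply: prepolar_sumset; first exact: nbhs0_doubling_closed.
    apply: filterS (nbhs_preimage (@gprod_fst_continuous G H 0) n1).
    by move=> x hx _ [_ [chi Schi <-] <-]; apply: hx; exists chi.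
  apply: filterS (nbhs_preimage (@gprod_snd_continuous G H 0) n2).
  by move=> x hx _ [_ [chi Schi <-] <-]; apply: hx; exists chi.
apply: filterS; apply: sub_prepolar => chi Schi.
exists (dual_inl (dual_fst chi)).
  by exists (dual_fst chi) => //; exists chi.
exists (dual_inr (dual_snd chi)); last exact: dual_prodE.
by exists (dual_snd chi) => //; exists chi.
Qed.

(** [Mac] is stable under products. For the last condition, the prepolar of
    [(n)(K * C) + F] contains [U1 * U2], where [U1] and [U2] are the prepolars of
    [(2n)K + (F1 + F1)] and [(2n)C + (F2 + F2)] and [F1], [F2] are the projections
    of [F]; restricting a homomorphism to each factor then reduces the condition
    to the same one for [K] and for [C]. *)
Lemma Mac_prod (K : set (dual R G)) (C : set (dual R H)) :
  Mac K -> Mac C -> Mac (@dual_prod R G H @^-1` (K `*` C)).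
Proof.
move=> [qK cK MK] [qC cC MC]; split.
- move=> chi /not_andP[/qK[xi Kxi nxi]|/qC[xi Cxi nxi]].
    have c : continuous (dual_hom xi \o @dual_fst R G H).
      move=> psi; apply: continuous_comp; first exact: dual_fst_continuous.
      exact: dual_continuous.
    exists (Dual c) => // _ [psi [Kpsi _] <-].
    by apply: Kxi; exists (dual_fst psi).
  have c : continuous (dual_hom xi \o @dual_snd R G H).
    move=> psi; apply: continuous_comp; first exact: dual_snd_continuous.
    exact: dual_continuous.
  exists (Dual c) => // _ [psi [_ Cpsi] <-].
  by apply: Cxi; exists (dual_snd psi).
- pose f (p : dual R G * dual R H) := dual_inl p.1 + dual_inr p.2.
  have -> : @dual_prod R G H @^-1` (K `*` C) = f @` (K `*` C).
    apply/seteqP; split=> [chi KCchi|_ [[a b] [/= Ka Cb] <-]].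
      by exists (dual_prod chi) => //; exact: dual_prodE.
    rewrite /f /= /dual_prod !raddfD/= dual_inlK dual_inrK.
    by rewrite dual_fst_inr dual_snd_inl addr0 add0r.
  apply: continuous_compact; last exact: compact_setX.
  apply: continuous_subspaceT => p.
  apply: (@continuous_comp _ _ _
    (fun p : dual R G * dual R H => (dual_inl p.1, dual_inr p.2))
    (fun z : dual R (gprod G H) * dual R (gprod G H) => z.1 + z.2));
    last exact: add_continuous.
  apply: (cvg_pair (G := nbhs (dual_inl p.1)) (H := nbhs (dual_inr p.2))).
    apply: (@continuous_comp _ _ _ fst dual_inl); first exact: cvg_fst.
    exact: dual_inl_continuous.
  apply: (@continuous_comp _ _ _ snd dual_inr); first exact: cvg_snd.
  exact: dual_inr_continuous.
- move=> F [//|n] finF F0 _ psi psiP.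
  set S := _ @^-1` _ in psiP.
  pose F1 := @dual_fst R G H @` F; pose F2 := @dual_snd R G H @` F.
  have F10 : F1 0 by exists 0 => //; exact: raddf0.
  have F20 : F2 0 by exists 0 => //; exact: raddf0.
  have K0 := quasi_convex0 qK; have C0 := quasi_convex0 qC.
  pose U1 := prepolar (sumset (nfold (n + n).+2 K) (sumset F1 F1)).
  pose U2 := prepolar (sumset (nfold (n + n).+2 C) (sumset F2 F2)).
  have U12 x : U1 x.1 -> U2 x.2 -> prepolar (sumset (nfold n.+1 S) F) x.
    move=> U1x U2x _ [s Ss [f Ff <-]].
    have h1 : sumset (nfold n.+1 K) F1 (dual_fst (s + f)).
      rewrite raddfD; exists (dual_fst s); last first.
        by exists (dual_fst f) => //; exists f.
      apply: (@nfold_additive _ _ (@dual_fst R G H) S) => [_ [t [Kt _] <-]//|].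
      by exists s.
    have h2 : sumset (nfold n.+1 C) F2 (dual_snd (s + f)).
      rewrite raddfD; exists (dual_snd s); last first.
        by exists (dual_snd f) => //; exists f.
      apply: (@nfold_additive _ _ (@dual_snd R G H) S) => [_ [t [_ Kt] <-]//|].
      by exists s.
    have [h1a h1b] := nfold_sumset_double K0 F10 h1.
    have [h2a h2b] := nfold_sumset_double C0 F20 h2.
    rewrite -[s + f]dual_prodE; apply: circle_plusD.
    + exact: (U1x _ h1a).
    + exact: (U1x _ h1b).
    + exact: (U2x _ h2a).
    + exact: (U2x _ h2b).
  have prepolar0 (T : topologicalZmodType) (B : set (dual R T)) : prepolar B 0.
    by move=> chi _; rewrite raddf0; exact: circle_plus0.
  apply: gprod_additive_continuous.
    apply: (MK (sumset F1 F1) (n + n).+2) => //.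
    + by apply: finite_image2; exact: finite_image.
    + by exists 0 => //; exists 0 => //; rewrite addr0.
    + move=> _ [g Ug <-]; apply: psiP; exists (gprod_inl H g) => //.
      by apply: U12 => //; exact: prepolar0.
  apply: (MC (sumset F2 F2) (n + n).+2) => //.
  + by apply: finite_image2; exact: finite_image.
  + by exists 0 => //; exists 0 => //; rewrite addr0.
  + move=> _ [g Ug <-]; apply: psiP; exists (gprod_inr G g) => //.
    by apply: U12 => //; exact: prepolar0.
Qed.

End DualOfProduct.

Lemma nbhs_polar_Mac (R : realType) (G : topologicalZmodType) (U : set G) :
  nbhs 0 U -> Mac (polar U : set (dual R G)).
Proof.
apply: polar_Mac => [|chi|A nA chi Achi].
- exact: nbhs0_doubling_closed.
- apply: (nbhs_preimage (@dual_continuous R G chi 0)).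
  by rewrite raddf0; exact: nbhs0_circle_plus.
- apply: character_continuous; apply: filterS nA => g Ag.
  by apply: Achi; exists g.
Qed.

(** An equicontinuous set is contained in the polar of its prepolar. *)
Lemma equicontinuous_sub_Mac (R : realType) (G : topologicalZmodType)
    (K : set (dual R G)) :
  equicontinuous_dual K -> exists2 C, Mac C & K `<=` C.
Proof.
move=> /equicontinuous_prepolar nK; exists (polar (prepolar K)).
  exact: nbhs_polar_Mac.
by move=> chi Kchi _ [g Kg <-]; exact: Kg.
Qed.

(** * Mackey products *)

Theorem theorem3p15 (R : realType) (G H : topologicalZmodType)
    (lqcG : locally_quasi_convex R G) (lqcH : locally_quasi_convex R H) :
  [<-> mackey R (gprod G H);
       forall S, Mac S ->
         equicontinuous_dual (@dual_fst R G H @` S) /\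
         equicontinuous_dual (@dual_snd R G H @` S);
       [/\ mackey R G, mackey R H &
         swallows [set K `*` C | K in @Mac R G & C in @Mac R H]
                  [set @dual_prod R G H @` S | S in @Mac R (gprod G H)]]].
Proof.
tfae.
- by move=> MGH S /(mackey_equicontinuous MGH)/equicontinuous_prod.
- move=> eqS.
  have MG0 : Mac (@polar R G setT) by apply: nbhs_polar_Mac; exact: filterT.
  have MH0 : Mac (@polar R H setT) by apply: nbhs_polar_Mac; exact: filterT.
  (* The polar of the whole group serves as the other factor in [Mac_prod];
     all that matters is that it contains [0]. *)
  have polar0 (T : topologicalZmodType) (U : set T) : polar U (0 : dual R T).
    by move=> _ [g _ <-]; exact: circle_plus0.
  split.
  + apply: equicontinuous_mackey => // K MK.
    have [+ _] := eqS _ (Mac_prod MK MH0); apply: equicontinuous_sub => chi Kchi.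
    exists (dual_inl H chi); last exact: dual_inlK.
    by split; rewrite /= ?dual_inlK// dual_snd_inl; exact: polar0.
  + apply: equicontinuous_mackey => // C MC.
    have [_] := eqS _ (Mac_prod MG0 MC); apply: equicontinuous_sub => chi Cchi.
    exists (dual_inr G chi); last exact: dual_inrK.
    by split; rewrite /= ?dual_inrK// dual_fst_inr; exact: polar0.
  + move=> _ [S MS <-]; have [/equicontinuous_sub_Mac[K MK SK]] := eqS _ MS.
    move=> /equicontinuous_sub_Mac[C MC SC]; exists (K `*` C).
      by exists K => //; exists C.
    by move=> _ [chi Schi <-]; split; [apply: SK|apply: SC]; exists chi.
- move=> [MG MH sw]; apply: equicontinuous_mackey => [|S MS].
    exact: gprod_locally_quasi_convex.
  have [|_ [K MK [C MC <-]] SKC] := sw (@dual_prod R G H @` S); first by exists S.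
  apply/equicontinuous_prod; split.
    apply: equicontinuous_sub (mackey_equicontinuous MG MK) => _ [chi Schi <-].
    by have [] := SKC (dual_prod chi) (ex_intro2 _ _ chi Schi erefl).
  apply: equicontinuous_sub (mackey_equicontinuous MH MC) => _ [chi Schi <-].
  by have [] := SKC (dual_prod chi) (ex_intro2 _ _ chi Schi erefl).
Qed.
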